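(* Let $G$ be an amenable group, $\mathbb{K}$ a field, and $V$ a finite-dimensional vector space over $\mathbb{K}$. Let $X \subset V^G$ be a strongly irreducible linear subshift of finite type and let $\tau \colon X \to X$ be a linear cellular automaton. Then $\tau$ is surjective if and only if it is pre-injective.
   Context: For a group $G$ and a set $A$, $A^G$ is the set of all maps (configurations) $x \colon G \to A$, equipped with the prodiscrete topology (the product topology obtained from the discrete topology on each factor $A$) and with the left $G$-action $(gx)(h) = x(g^{-1}h)$. A subshift is a closed $G$-invariant subset $X \subset A^G$. For $\Omega \subset G$, $x\vert_\Omega$ denotes restriction. Strong irreducibility: for a finite subset $\Delta \subset G$, a subshift $X \subset A^G$ is $\Delta$-irreducible if, whenever $\Omega_1,\Omega_2$ are finite subsets of $G$ such that there is no $g \in \Omega_2$ with $g\Delta \cap \Omega_1 \neq \varnothing$, then for all $x_1,x_2 \in X$ there is $x \in X$ with $x\vert_{\Omega_1} = x_1\vert_{\Omega_1}$ and $x\vert_{\Omega_2} = x_2\vert_{\Omega_2}$. $X$ is strongly irreducible if it is $\Delta$-irreducible for some finite $\Delta \subset G$. Finite type: for a finite $D \subset G$ and $L \subset A^D$, put $X_G(D,L) = \{x \in A^G : (g^{-1}x)\vert_D \in L \text{ for all } g \in G\}$. A subshift $X$ is of finite type if $X = X_G(D,L)$ for some finite $D \subset G$ and some $L \subset A^D$. Cellular automata: a map $\tau \colon X \to Y$ between subshifts $X,Y \subset A^G$ is a cellular automaton if there are a finite subset $M \subset G$ and a map $\mu \colon A^M \to A$ with $\tau(x)(g) = \mu((g^{-1}x)\vert_M)$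 for all $x \in X$, $g \in G$ (where $(g^{-1}x)\vert_M(m) = x(gm)$). It is pre-injective if whenever $x_1,x_2 \in X$ coincide outside a finite subset of $G$ and $\tau(x_1) = \tau(x_2)$, then $x_1 = x_2$. Linear setting: if $V$ is a vector space over $\mathbb{K}$, $V^G$ has its product vector space structure; a linear subshift is a subshift $X \subset V^G$ that is a vector subspace of $V^G$, and a linear cellular automaton between linear subshifts is a cellular automaton that is a $\mathbb{K}$-linear map. *)

(* Defs.v *)
From HB Require Import structures.
From mathcomp Require Import all_boot all_order all_algebra.
From mathcomp Require Import all_classical all_reals all_analysis.

Set Implicit Arguments.
Unset Strict Implicit.
Unset Printing Implicit Defensive.

Import Order.TTheory GRing.Theory Num.Theory.

Local Open Scope classical_set_scope.
Local Open Scope ring_scope.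

Definition lmulset (G : groupType) (g : G) (A : set G) : set G :=
  [set (g * a)%g | a in A].

(* Amenability in von Neumann's sense: there is a left-invariant finitely
   additive probability measure on the power set of [G].  [R] is the field of
   real numbers in which the measure takes its values. *)
Definition amenable (R : realType) (G : groupType) : Prop :=
  exists m : set G -> R,
    [/\ forall A, 0 <= m A,
        m setT = 1,
        forall A B, A `&` B = set0 -> m (A `|` B) = m A + m B
      & forall g A, m (lmulset g A) = m A].

Section Configurations.
Variables (G : groupType) (A : choiceType).
Implicit Types (X Y : set (G -> A)) (x : G -> A) (g : G).

Definition shift g x : G -> A := fun h => x (g^-1 * h)%g.

Definition subshift X : Prop :=
  @closed {ptws G -> discrete_topology A} X /\
  (forall g x, X x -> X (shift g x)).

(* Throughout, [sigL W x : W -> A] is the restriction of [x] to [W]. *)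

Definition irreducible_wrt (Delta : set G) X : Prop :=
  forall Omega1 Omega2 : set G, finite_set Omega1 -> finite_set Omega2 ->
    ~ (exists2 g, Omega2 g & lmulset g Delta `&` Omega1 !=set0) ->
    forall x1 x2, X x1 -> X x2 ->
      exists x, [/\ X x, sigL Omega1 x = sigL Omega1 x1
                       & sigL Omega2 x = sigL Omega2 x2].

Definition strongly_irreducible X : Prop :=
  exists Delta : set G, finite_set Delta /\ irreducible_wrt Delta X.

Definition XG (D : set G) (L : set (D -> A)) : set (G -> A) :=
  [set x | forall g, L (sigL D (shift g^-1%g x))].

Definition finite_type X : Prop :=
  exists (D : set G) (L : set (D -> A)), finite_set D /\ X = XG L.

(* A map X -> Y is represented by a map of the full shift sending X into Y;
   here and below its values outside X are irrelevant. *)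
Definition cellular_automaton X Y (tau : (G -> A) -> (G -> A)) : Prop :=
  set_fun X Y tau /\
  exists (M : set G) (mu : (M -> A) -> A), finite_set M /\
    forall x, X x -> forall g, tau x g = mu (sigL M (shift g^-1%g x)).

Definition pre_injective X (tau : (G -> A) -> (G -> A)) : Prop :=
  forall x1 x2, X x1 -> X x2 ->
    (exists F : set G, finite_set F /\ sigL (~` F) x1 = sigL (~` F) x2) ->
    tau x1 = tau x2 -> x1 = x2.

End Configurations.

Section Linear.
Variables (G : groupType) (K : fieldType) (V : vectType K).
Implicit Types X Y : set (G -> V).

Definition linear_subshift X : Prop :=
  subshift X /\ GRing.submod_closed [in X].

Definition linear_cellular_automaton X Y (tau : (G -> V) -> (G -> V)) : Prop :=
  cellular_automaton X Y tau /\
  (forall (a : K) x y, X x -> X y -> tau (a *: x + y) = a *: tau x + tau y).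

End Linear.

(* Main.v *)
Require Import Defs.
From HB Require Import structures.
From mathcomp Require Import all_boot all_order all_algebra.
From mathcomp Require Import all_classical all_reals all_analysis.
From mathcomp Require Import finmap zify.

(** Both implications compare dimensions over a Folner set.  Write [restr F] for
    the restriction to a finite set [F] of sites, and let [rank S f] be the
    dimension of the image of a subspace [S] of [V^G] under a map [f] linear on
    it.  Passing from [F0] to a larger [F] raises [rank X (restr F)] by at most
    [\dim V * #|F \ F0|] ([rank_restr_le]).  If [F0] is almost invariant under
    right translation by a finite set [A], and [F = F0 A], this increment is a
    tiny fraction of [#|F0|].  By contrast, if injectivity or surjectivity fails
    somewhere, it fails by translation at every site, hence independently at
    every point of a separated set [T] of size at least a constant times
    [#|F0|].  The lemma [amenable_sparse] provides [F0] and [T] such that the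
    gain [#|T|] exceeds the boundary term, for constants fixed in advance.

    Surjective implies pre-injective: let [z] be a nonzero finitely supported
    element of [X] killed by [tau].  The rank of [restr F0 \o tau] on [X] is that
    of [restr F0], because [tau] is onto.  It is also at most
    [rank X (restr F) - #|T|], since [tau x] on [F0] depends only on [x] on [F]
    and the [#|T|] independent translates of [z] lie in the kernel.

    Pre-injective implies surjective: suppose that [tau] misses a point of [X].
    By linear compactness of [V^G] ([affine_compactness]) the image of [tau] is
    closed, so some linear functional on a finite window [W] vanishes on the
    image of [tau] but not on [X].  Strong irreducibility makes its translates at
    [T] independent on [X]; they cut [#|T|] dimensions off the image of [tau].
    On the other hand, strong irreducibility together with finite type extends
    every pattern of [X] on [F0] to an element of [X] supported in a bounded
    neighbourhood of [F0] ([finite_support_extension]).  On such elements [tau]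
    is injective, so its image has rank at least [rank X (restr F0)].

    Folner sets come from the invariant mean through Hall's marriage theorem for
    infinite families of finite sets.  If all finite [F] satisfied
    [(n+1) #|F| <= n #|F A|], Hall would inject [n+1] copies of [G] into [n]
    copies by moving each point along an element of [A]; the mean does not see
    such moves, and would give [n + 1 <= n]. *)

Set Implicit Arguments.
Unset Strict Implicit.
Unset Printing Implicit Defensive.

Import Order.TTheory GRing.Theory Num.Theory.

Local Open Scope classical_set_scope.
Local Open Scope ring_scope.

(** * Ranks of maps on subspaces of infinite-dimensional spaces *)

Definition subspace (K : fieldType) (E : lmodType K) (S : set E) : Prop :=
  S 0 /\ forall a x y, S x -> S y -> S (a *: x + y).

Section Rank.
Variables (K : fieldType) (E : lmodType K).
Implicit Types (W : vectType K) (S : set E).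

Definition linear_on W S (f : E -> W) : Prop :=
  forall a x y, S x -> S y -> f (a *: x + y) = a *: f x + f y.

(** A subspace of maximal dimension among those contained in [P] must be all of
    [P], since any further vector of [P] could be adjoined to it. *)
Lemma subspace_vspace W (P : set W) :
  subspace P -> exists U : {vspace W}, forall w, w \in U <-> P w.
Proof.
move=> [P0 PL].
pose good n :=
  `[< exists U : {vspace W}, \dim U = n /\ forall w, w \in U -> P w >].
have good0 : exists n, good n.
  exists 0%N; apply/asboolP; exists 0%VS; rewrite dimv0; split=> // w.
  by rewrite memv0 => /eqP ->.
have good_bound n : good n -> (n <= \dim {:W})%N.
  by move=> /asboolP[U [<- _]]; apply/dimvS/subvf.
have [n /asboolP[U [dimU UP]] maxn] := ex_maxnP good0 good_bound.
exists U => w; split=> [/UP //|Pw]; apply/negPn/negP => wU.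
have : good (\dim (<[w]> + U)).
  apply/asboolP; exists (<[w]> + U)%VS; split=> // v.
  by move=> /memv_addP[_ /vlineP[a ->]] [u uU ->]; apply: PL => //; exact: UP.
move=> /maxn; rewrite -dimU => le_dim.
have := dimv_leqif_sup (addvSr <[w]> U); move=> [_].
rewrite eqn_leq le_dim dimvS ?addvSr //= => /esym.
by move=> /subvP/(_ w)/(_ (subvP (addvSl _ _) _ (memv_line w))); apply/negP.
Qed.

(** Only linearity on [S] is asked of the maps, since a cellular automaton is
    linear only on its subshift.  The default value is never met when [S] is a
    subspace and [f] is linear on it. *)
Definition image_vspace W S (f : E -> W) : {vspace W} :=
  xget 0%VS [set U | forall w, w \in U <-> exists2 x, S x & f x = w].

Definition rank W S (f : E -> W) : nat := \dim (image_vspace S f).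

Lemma image_vspaceP W S (f : E -> W) : subspace S -> linear_on S f ->
  forall w, w \in image_vspace S f <-> exists2 x, S x & f x = w.
Proof.
move=> [S0 SL] fL; rewrite /image_vspace; case: xgetP => [U _ //|noU].
have [|U UP] := @subspace_vspace W [set w | exists2 x, S x & f x = w].
  split; first by exists 0 => //; have := fL (-1) 0 0 S0 S0;
    rewrite !scaleN1r !addNr.
  move=> a _ _ [x Sx <-] [y Sy <-].
  by exists (a *: x + y); [exact: SL|exact: fL].
by case: (noU U).
Qed.

Lemma linear_on0 W S (f : E -> W) : subspace S -> linear_on S f -> f 0 = 0.
Proof.
by move=> [S0 _] fL; have := fL (-1) 0 0 S0 S0; rewrite !scaleN1r !addNr.
Qed.

Definition ker_on W S (f : E -> W) : set E := [set x | S x /\ f x = 0].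

Lemma subspace_ker W S (f : E -> W) : subspace S -> linear_on S f ->
  subspace (ker_on S f).
Proof.
move=> SS fL; split; first by split; [exact: SS.1|exact: (linear_on0 SS)].
move=> a x y [Sx fx] [Sy fy]; split; first exact: SS.2.
by rewrite fL // fx fy scaler0 addr0.
Qed.

Lemma linear_on_sub W S S' (f : E -> W) :
  S' `<=` S -> linear_on S f -> linear_on S' f.
Proof. by move=> S'S fL a x y /S'S Sx /S'S Sy; exact: fL. Qed.

Definition pairf W1 W2 (f : E -> W1) (g : E -> W2) (x : E) : (W1 * W2)%type :=
  (f x, g x).

Lemma linear_on_pair W1 W2 S (f : E -> W1) (g : E -> W2) :
  linear_on S f -> linear_on S g -> linear_on S (pairf f g).
Proof. by move=> fL gL a x y Sx Sy; rewrite /pairf fL // gL. Qed.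

(** Rank-nullity: project the image of the pair to its first component.  The
    kernel of that projection is the image under [g] of the kernel of [f]. *)
Lemma rank_pairl W1 W2 S (f : E -> W1) (g : E -> W2) :
  subspace S -> linear_on S f -> linear_on S g ->
  rank S (pairf f g) = (rank S f + rank (ker_on S f) g)%N.
Proof.
move=> SS fL gL; have pL := linear_on_pair fL gL.
have kS := subspace_ker SS fL.
have gkL : linear_on (ker_on S f) g.
  by apply: linear_on_sub gL => x [].
pose p1 : 'Hom((W1 * W2)%type, W1) := linfun fst.
pose p2 : 'Hom((W1 * W2)%type, W2) := linfun snd.
set U := image_vspace S (pairf f g).
have UP := image_vspaceP SS pL; rewrite -/U in UP.
rewrite /rank -/U -(limg_ker_dim p1 U) addnC; congr (_ + _)%N.
  congr (\dim _); apply/vspaceP => w; apply/idP/idP.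
    move=> /memv_imgP[u /UP[x Sx <-] ->]; rewrite lfunE.
    by apply/(image_vspaceP SS fL); exists x.
  move=> /(image_vspaceP SS fL)[x Sx <-]; apply/memv_imgP.
  by exists (f x, g x); [apply/UP; exists x|rewrite lfunE].
rewrite -(@limg_dim_eq _ _ _ p2); last first.
  apply/eqP; rewrite -subv0; apply/subvP => -[w1 w2].
  rewrite !memv_cap !memv_ker memv0 /p1 /p2 !lfunE /=.
  by move=> /andP[/andP[_ /eqP->] /eqP->].
congr (\dim _); apply/vspaceP => w; apply/idP/idP.
  move=> /memv_imgP[u]; rewrite memv_cap memv_ker => /andP[/UP[x Sx <-]].
  rewrite /p1 /p2 !lfunE /= => /eqP fx0 ->.
  by apply/(image_vspaceP kS gkL); exists x.
move=> /(image_vspaceP kS gkL)[x [Sx fx0] <-]; apply/memv_imgP.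
exists (f x, g x); last by rewrite lfunE.
rewrite memv_cap memv_ker lfunE /= fx0 eqxx andbT.
by apply/UP; exists x; rewrite // /pairf fx0.
Qed.

Lemma rank_pairC W1 W2 S (f : E -> W1) (g : E -> W2) :
  subspace S -> linear_on S f -> linear_on S g ->
  rank S (pairf f g) = (rank S g + rank (ker_on S g) f)%N.
Proof.
move=> SS fL gL; rewrite -rank_pairl //; rewrite /rank.
have UP := image_vspaceP SS (linear_on_pair fL gL).
have VP := image_vspaceP SS (linear_on_pair gL fL).
set U := image_vspace S (pairf f g) in UP *.
set V := image_vspace S (pairf g f) in VP *.
pose s : 'Hom((W1 * W2)%type, (W2 * W1)%type) := linfun (fun w => (w.2, w.1)).
have sE w : s w = (w.2, w.1).
  have sL : linear (fun w : W1 * W2 => (w.2, w.1)) by [].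
  pose sm := GRing.isLinear.Build _ _ _ _ _ sL.
  pose sl : {linear _ -> _} := HB.pack (fun w : W1 * W2 => (w.2, w.1)) sm.
  by rewrite /s (lfunE sl).
rewrite -(@limg_dim_eq _ _ _ s); last first.
  apply/eqP; rewrite -subv0; apply/subvP => -[w1 w2].
  by rewrite !memv_cap !memv_ker memv0 sE => /andP[_ /eqP[-> ->]].
congr (\dim _); apply/vspaceP => w; apply/idP/idP.
  by move=> /memv_imgP[u /UP[x Sx <-] ->]; rewrite sE; apply/VP; exists x.
move=> /VP[x Sx <-]; apply/memv_imgP; exists (f x, g x); last by rewrite sE.
by apply/UP; exists x.
Qed.

Lemma rank_eq0 W S (f : E -> W) : subspace S -> linear_on S f ->
  (forall x, S x -> f x = 0) -> rank S f = 0%N.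
Proof.
move=> SS fL f0; apply/eqP; rewrite dimv_eq0 -subv0; apply/subvP => w.
by move=> /(image_vspaceP SS fL)[x Sx <-]; rewrite f0 // mem0v.
Qed.

Lemma rank_le_image W S S' (f f' : E -> W) :
  subspace S -> linear_on S f -> subspace S' -> linear_on S' f' ->
  (forall x, S x -> exists2 x', S' x' & f' x' = f x) ->
  (rank S f <= rank S' f')%N.
Proof.
move=> SS fL SS' fL' sub; apply/dimvS/subvP => w.
move=> /(image_vspaceP SS fL)[x /sub Sx <-].
by apply/(image_vspaceP SS' fL').
Qed.

(** Under the hypothesis [g] factors through [f]: in both expansions of the rank
    of the pair, the one through [f] has no correction term. *)
Lemma rank_le_factor W1 W2 S (f : E -> W1) (g : E -> W2) :
  subspace S -> linear_on S f -> linear_on S g ->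
  (forall x, S x -> f x = 0 -> g x = 0) -> (rank S g <= rank S f)%N.
Proof.
move=> SS fL gL fg; have := rank_pairC SS fL gL.
rewrite rank_pairl // [X in (_ + X)%N]rank_eq0 ?addn0 => [->|||x []].
- exact: leq_addr.
- exact: subspace_ker.
- by apply: linear_on_sub gL => x [].
- exact: fg.
Qed.

Lemma rank_pair_le W1 W2 S (f : E -> W1) (g : E -> W2) :
  subspace S -> linear_on S f -> linear_on S g ->
  (rank S (pairf f g) <= rank S f + \dim {:W2})%N.
Proof. by move=> *; rewrite rank_pairl // leq_add2l dimvS ?subvf. Qed.

Lemma rank_ker W1 W2 S (f : E -> W1) (g : E -> W2) :
  subspace S -> linear_on S f -> linear_on S g ->
  (forall x, S x -> f x = 0 -> g x = 0) ->
  (rank S g + rank (ker_on S g) f)%N = rank S f.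
Proof.
move=> SS fL gL fg; rewrite -rank_pairC // rank_pairl //.
rewrite [X in (_ + X)%N]rank_eq0 ?addn0 // => [||x []].
- exact: subspace_ker.
- by apply: linear_on_sub gL => x [].
- exact: fg.
Qed.

End Rank.

(** Project onto a complement of [U], read a nonzero coordinate of the image of
    [w], and normalise. *)
Lemma separating_functional (K : fieldType) (W : vectType K) (U : {vspace W})
    (w : W) : w \notin U ->
  exists l : W -> K, [/\ linear (l : W -> K^o),
    forall u, u \in U -> l u = 0 & l w = 1].
Proof.
move=> wU; pose v := w - projv U w.
have v0 : v != 0.
  by apply: contra wU; rewrite subr_eq0 => /eqP ->; exact: memv_proj.
have vf : v \in {:W}%VS by rewrite memvf.
have [i ci] : exists i, coord (vbasis {:W}) i v != 0.
  apply/existsP; rewrite -negb_forall; apply: contra v0 => /forallP c0.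
  rewrite (coord_vbasis vf) big1 // => i _.
  by have := c0 i => /eqP ->; rewrite scale0r.
pose c := coord (vbasis {:W}) i v.
exists (fun u => c^-1 * coord (vbasis {:W}) i (u - projv U u)); split.
- move=> a x y; rewrite linearP opprD addrACA -scalerBr linearP /=.
  by rewrite mulrDr mulrCA.
- by move=> u uU; rewrite projv_id // subrr linear0 mulr0.
- by rewrite mulVf.
Qed.

(** * Hall's marriage theorem for infinite families of finite sets *)

(** A finite part of the union of a chain is already seen at one stage: the
    finiteness on which Zorn's lemma will rely. *)
Lemma chain_finite_witness (T : eqType) (F : set (set T)) (D0 : set T)
    (s : seq T) :
  total_on F subset -> F D0 ->
  exists2 D, F D & forall x, x \in s -> (\bigcup_(X in F) X) x -> D x.
Proof.
move=> Ftot FD0; elim: s => [|y s [D FD Ds]]; first by exists D0.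
case: (pselect ((\bigcup_(X in F) X) y)) => [[D' FD' D'y]|ny].
  have [DD'|D'D] := Ftot _ _ FD FD'.
    exists D' => // x; rewrite inE => /predU1P[->//|xs] Ux.
    by apply: DD'; exact: Ds.
  exists D => // x; rewrite inE => /predU1P[-> _|xs Ux]; first exact: D'D.
  exact: Ds.
by exists D => // x; rewrite inE => /predU1P[->|xs] Ux //; exact: Ds.
Qed.

Section Hall.
Variables (I J : choiceType) (E : I -> {fset J}).

(* [D] is a set of deleted edges of the bipartite graph [E]. *)
Let kept (D : set (I * J)) (i : I) : {fset J} :=
  [fset j in E i | (i, j) \notin D]%fset.
Let nbh D (S : {fset I}) : {fset J} := (\bigcup_(i <- S) kept D i)%fset.
Let hall_cond D := forall S : {fset I}, (#|` S| <= #|` nbh D S|)%N.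

Let keptP D i j : reflect (j \in E i /\ ~ D (i, j)) (j \in kept D i).
Proof.
rewrite !inE /=; apply: (iffP andP) => -[jE nD]; split=> //.
  by move/mem_set; apply/negP.
by apply/negP => /set_mem.
Qed.

Let nbhP D (S : {fset I}) j :
  reflect (exists2 i, i \in S & j \in kept D i) (j \in nbh D S).
Proof.
apply: (iffP (bigfcupP _ _ _ _)) => [[i /andP[iS _] jk]|[i iS jk]].
  by exists i.
by exists i => //; rewrite iS.
Qed.

Let hall_chain (F : set (set (I * J))) : hall_cond set0 ->
  F `<=` hall_cond -> total_on F subset -> hall_cond (\bigcup_(X in F) X).
Proof.
move=> h0 Fh Ftot S; have [->|/set0P[D0 FD0]] := eqVneq F set0.
  by rewrite bigcup_set0.
have [D FD DP] := chain_finite_witness [seq (i, j) | i <- S, j <- E i] Ftot FD0.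
apply: leq_trans (Fh _ FD S) _; apply/fsubset_leq_card/fsubsetP => j.
move=> /nbhP[i iS /keptP[jE nD]]; apply/nbhP; exists i => //.
apply/keptP; split=> // UD; apply: nD; apply: DP UD.
by apply/allpairsPdep; exists i, j.
Qed.

(* Rado's argument.  If two edges at [i] survived a maximal deletion, deleting
   either would violate Hall's condition on some [S], respectively [T],
   containing [i]; the neighbourhoods [P] and [Q] then contradict the
   submodularity count #|P| + #|Q| >= #|S `|` T| + #|S `&` T| - 1. *)
Let kept_unique D : hall_cond D -> (forall D', D `<` D' -> ~ hall_cond D') ->
  forall i j k, j \in kept D i -> k \in kept D i -> j = k.
Proof.
move=> hD maxD i j k jD kD; apply/eqP/negPn/negP => jk.
have blocked l : l \in kept D i ->
    exists2 S : {fset I}, i \in S &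
      (#|` nbh (D `|` [set (i, l)]) S| < #|` S|)%N.
  move=> lD; have := maxD (D `|` [set (i, l)]).
  have DD : D `<` D `|` [set (i, l)].
    split; first exact: subsetUl.
    by move=> /(_ (i, l)) Dil; have /keptP[_] := lD; apply; apply: Dil; right.
  move=> /(_ DD) /existsNP[S /negP]; rewrite -ltnNge => ltS.
  exists S => //; apply/negPn/negP => iS.
  move: ltS; rewrite ltnNge => /negP; apply; apply: leq_trans (hD S) _.
  apply/fsubset_leq_card/fsubsetP => x /nbhP[i' i'S /keptP[xE nD]].
  apply/nbhP; exists i' => //; apply/keptP; split=> // -[//|[ii' _]].
  by rewrite -ii' i'S in iS.
have [S iS ltS] := blocked j jD; have [T iT ltT] := blocked k kD.
set P := nbh _ S in ltS; set Q := nbh _ T in ltT.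
have leU : (#|` (S `|` T)%fset| <= #|` (P `|` Q)%fset|)%N.
  apply: leq_trans (hD _) _; apply/fsubset_leq_card/fsubsetP => x.
  move=> /nbhP[i' i'ST /keptP[xE nD]].
  have [e|ne] := eqVneq i' i.
    rewrite inE; have [xj|xj] := eqVneq x j; apply/orP; [right|left].
      apply/nbhP; exists i => //; apply/keptP; subst; split=> // -[//|[xk]].
      by rewrite xk eqxx in jk.
    apply/nbhP; exists i => //; apply/keptP; subst; split=> // -[//|[xk]].
    by rewrite xk eqxx in xj.
  have nD' l : ~ (D `|` [set (i, l)]) (i', x).
    by move=> -[//|[e _]]; rewrite e eqxx in ne.
  rewrite inE; apply/orP; move: i'ST; rewrite inE => /orP[i'S|i'T].
    by left; apply/nbhP; exists i' => //; apply/keptP.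
  by right; apply/nbhP; exists i' => //; apply/keptP.
have leI : (#|` ((S `&` T) `\ i)%fset| <= #|` (P `&` Q)%fset|)%N.
  apply: leq_trans (hD _) _; apply/fsubset_leq_card/fsubsetP => x.
  move=> /nbhP[i' + /keptP[xE nD]]; rewrite !inE => /and3P[ne i'S i'T].
  have nD' l : ~ (D `|` [set (i, l)]) (i', x).
    by move=> -[//|[e _]]; rewrite e eqxx in ne.
  apply/andP; split; apply/nbhP; exists i' => //; exact/keptP.
have iST : i \in (S `&` T)%fset by rewrite inE iS iT.
have := cardfsUI S T; have := cardfsUI P Q; have := cardfsD1 i (S `&` T)%fset.
rewrite iST; lia.
Qed.

(** A maximal deletion preserving Hall's condition leaves exactly one edge at
    each [i], and Hall's condition on pairs makes the resulting choice injective. *)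
Lemma hall :
  (forall S : {fset I}, #|` S| <= #|` (\bigcup_(i <- S) E i)%fset|)%N ->
  exists phi : I -> J, injective phi /\ forall i, phi i \in E i.
Proof.
move=> hE; have h0 : hall_cond set0.
  move=> S; apply: leq_trans (hE S) _; apply/fsubset_leq_card/fsubsetP => x.
  move=> /bigfcupP[i /andP[iS _] xi]; apply/nbhP; exists i => //.
  by apply/keptP; split.
have [D [hD maxD]] := Zorn_bigcup (fun F => @hall_chain F h0).
have uniqD := kept_unique hD maxD.
have /choice[phi phiD] : forall i, exists j, j \in kept D i.
  move=> i; have := hD [fset i]%fset; rewrite cardfs1 cardfs_gt0.
  by move=> /fset0Pn[j /nbhP[i' /fset1P->]]; exists j.
exists phi; split; last by move=> i; have /keptP[] := phiD i.
move=> i i' e; apply/eqP/negPn/negP => ne.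
have := hD [fset i; i']%fset; rewrite cardfs2 ne leqNgt => /negP; apply.
rewrite ltnS.
apply: (@leq_trans #|` [fset phi i]%fset|); last by rewrite cardfs1.
apply/fsubset_leq_card/fsubsetP => x.
move=> /nbhP[k /fset2P[]-> xk]; apply/fset1P.
  exact: uniqD _ _ _ xk (phiD i).
by rewrite e; exact: uniqD _ _ _ xk (phiD i').
Qed.

End Hall.

(** * From an invariant mean to Folner sets *)

Lemma card_fsetM (I J : choiceType) (A : {fset I}) (B : {fset J}) :
  #|` (A `*` B)%fset| = (#|` A| * #|` B|)%N.
Proof.
have /perm_size : perm_eq (A `*` B)%fset [seq (a, b) | a <- A, b <- B].
  apply: uniq_perm => [||[a b]].
  - exact: fset_uniq.
  - by apply: allpairs_uniq => [||[? ?] [? ?]//]; exact: fset_uniq.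
  - rewrite in_fsetM; apply/andP/allpairsP => [[aA bB]|[[c d] [cA dB [-> ->]]]//].
    by exists (a, b).
by rewrite size_allpairs.
Qed.

Section FinitelyAdditive.
Variables (R : realType) (T : Type) (m : set T -> R).
Hypotheses (m_ge0 : forall A, 0 <= m A) (m1 : m setT = 1).
Hypothesis mD : forall A B, A `&` B = set0 -> m (A `|` B) = m A + m B.

Lemma fin_additive_le1 A : m A <= 1.
Proof.
by rewrite -m1 -(setvU A) mD ?setICl // lerDr.
Qed.

Lemma fin_additive_sum (I : finType) (F : I -> set T) :
  (forall i j x, F i x -> F j x -> i = j) ->
  m [set x | exists i, F i x] = \sum_i m (F i).
Proof.
move=> Fdisj.
have m0 : m set0 = 0.
  by apply: (@addrI _ (m set0)); rewrite addr0 -mD ?setU0 ?setI0.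
suff H (s : seq I) : uniq s ->
    m [set x | exists2 i, i \in s & F i x] = \sum_(i <- s) m (F i).
  rewrite /index_enum -enumT -H ?enum_uniq //; congr m.
  apply/seteqP; split=> x /=; first by case=> i Fix; exists i; rewrite ?mem_enum.
  by case=> i _ Fix; exists i.
elim: s => [_|i s IH /= /andP[nis /IH {}IH]].
  by rewrite big_nil -[RHS]m0; congr m; apply/seteqP; split=> x // [].
rewrite big_cons -IH -mD.
  congr m; apply/seteqP; split=> x /=.
    by case=> j; rewrite inE => /predU1P[->|js] Fj; [left|right; exists j].
  case=> [Fi|[j js Fj]]; [exists i|exists j] => //; rewrite inE ?eqxx //.
  by rewrite js orbT.
apply/seteqP; split=> x //= [Fi [j js Fj]].
by move: nis; rewrite (Fdisj _ _ _ Fi Fj) js.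
Qed.

End FinitelyAdditive.

Section Folner.
Variable G : groupType.
Implicit Types F A B T : {fset G}.

Definition fmulset F A : {fset G} := [fset (g * a)%g | g in F, a in A]%fset.

Lemma fmulsetP F A h :
  reflect (exists g a, [/\ g \in F, a \in A & h = (g * a)%g]) (h \in fmulset F A).
Proof.
apply: (iffP (imfset2P _ _ _ _ _)) => [[g /= gF [a /= aA ->]]|[g [a [gF aA ->]]]].
  by exists g, a.
by exists g => //; exists a.
Qed.

Lemma mem_fmulset F A g a : g \in F -> a \in A -> (g * a)%g \in fmulset F A.
Proof. by move=> gF aA; apply/fmulsetP; exists g, a. Qed.

(** The sets expand on the right because a cellular automaton looks at the sites
    [g * m]; the given mean is left-invariant, so the proof works with its image
    [mu] under inversion.  If no [F] works, Hall provides an injection [phi] of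
    [G * 'I_n.+1] into [G * 'I_n] with [phi (g, i)] of the form [(g * a, j)].
    Cutting [G] according to [a] and [j] and summing [mu] over all the pieces
    gives [n + 1] on the source side, and at most [n] on the target side, since
    right translation by [a] preserves [mu]. *)
Lemma amenable_folner (R : realType) : amenable R G ->
  forall A n, exists F, (n * #|` (fmulset F A `\` F)%fset| < #|` F|)%N.
Proof.
move=> [m [m_ge0 m1 mD mL]] A n; apply: contrapT => /forallNP noF.
(* Adding the identity leaves the boundary unchanged and gives [F] inside [F A1]. *)
pose A1 := (1%g |` A)%fset.
have expand F : (n.+1 * #|` F| <= n * #|` fmulset F A1|)%N.
  have FA : fmulset F A1 = (F `|` (fmulset F A `\` F))%fset.
    apply/fsetP => h; rewrite !inE; apply/fmulsetP/orP.
      move=> [g [a [gF aA ->]]]; move: aA; rewrite !inE => /predU1P[->|aA].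
        by left; rewrite mulg1.
      by case: (boolP (_ \in F)) => hF; [left|right; exact: mem_fmulset].
    case=> [hF|/andP[_ /fmulsetP[g [a [gF aA ->]]]]].
      by exists h, 1%g; rewrite hF mulg1 !inE eqxx.
    by exists g, a; rewrite gF !inE aA orbT.
  have := noF F; move/negP; rewrite -leqNgt.
  rewrite FA cardfsU (_ : (F `&` _)%fset = fset0) ?cardfs0; last first.
    by apply/fsetP => h; rewrite !inE; case: (h \in F).
  by rewrite subn0 mulnDr mulSn addnC leq_add2l.
pose E (x : G * 'I_n.+1) : {fset G * 'I_n} :=
  ([fset (x.1 * a)%g | a in A1] `*` [fset j in 'I_n])%fset.
have [S|phi [phiI phiE]] := @hall _ _ E.
  pose F := [fset x.1 | x in S]%fset.
  apply: (@leq_trans #|` (F `*` [fset j in 'I_n.+1])%fset|).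
    apply/fsubset_leq_card/fsubsetP => x xS; rewrite in_fsetM !inE andbT.
    by apply/imfsetP; exists x.
  apply: (@leq_trans #|` (fmulset F A1 `*` [fset j in 'I_n])%fset|).
    by rewrite !card_fsetM !card_finset !card_ord mulnC [leqRHS]mulnC.
  apply/fsubset_leq_card/fsubsetP => -[h j]; rewrite in_fsetM /= => /andP[].
  move=> /fmulsetP[g [a [/imfsetP[x /= xS ->] aA ->]]] jI.
  apply/bigfcupP; exists x; first by rewrite xS.
  by rewrite in_fsetM jI andbT; apply/imfsetP; exists a.
pose mu (B : set G) := m [set (g^-1)%g | g in B].
have muE (B : set G) : mu B = m [set g | B (g^-1)%g].
  congr m; apply/seteqP; split=> g /=; first by case=> h Bh <-; rewrite invgK.
  by move=> Bg; exists (g^-1)%g => //; rewrite invgK.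
have mu_ge0 (B : set G) : 0 <= mu B by exact: m_ge0.
have mu1 : mu setT = 1 by rewrite muE -m1.
have muD (B C : set G) : B `&` C = set0 -> mu (B `|` C) = mu B + mu C.
  move=> BC; rewrite !muE -mD //; rewrite -subset0 => g [Bg Cg].
  by have : set0 (g^-1)%g by rewrite -BC.
have muR (B : set G) a : mu [set h | B (h * a^-1)%g] = mu B.
  rewrite !muE -[RHS](mL (a^-1)%g); congr m; apply/seteqP; split=> g /=.
    by move=> Bg; exists (a * g)%g; rewrite /= ?invgM ?mulKg.
  by move=> [h Bh <-]; rewrite invgM invgK mulgK.
pose C i (a : A1) j := [set g | phi (g, i) = (g * val a, j)%g].
have sumR i : \sum_(p : A1 * 'I_n) mu (C i p.1 p.2) = 1.
  rewrite -fin_additive_sum // => [|[a j] [a' j'] g]; last first.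
    by rewrite /C /= => -> [/mulgI/val_inj -> ->].
  rewrite -mu1; congr mu; apply/seteqP; split=> g //= _.
  have := phiE (g, i); rewrite in_fsetM /= => /andP[/imfsetP[a /= aA e] _].
  exists ([` aA]%fset, (phi (g, i)).2).
  by rewrite /C /=; case: (phi (g, i)) e => /= h j ->.
have sumL j : \sum_(p : 'I_n.+1 * A1) mu (C p.1 p.2 j) <= 1.
  under eq_bigr => p _ do rewrite -(muR _ (val p.2)).
  rewrite -fin_additive_sum //; first exact: fin_additive_le1.
  move=> [i a] [i' a'] h; rewrite /C /= => e e'.
  have := phiI (h * (val a)^-1, i)%g (h * (val a')^-1, i')%g.
  rewrite e e' !mulgVK => /(_ erefl)[/mulgI/invg_inj/val_inj -> ->].
  by [].
have : \sum_(i : 'I_n.+1) (1 : R) <= \sum_(j : 'I_n) 1.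
  under eq_bigr => i _ do
    rewrite -(sumR i) -(pair_bigA _ (fun a j => mu (C i a j))).
  rewrite pair_bigA exchange_big /=; apply: ler_sum => j _; exact: sumL.
by rewrite !sumr_const !card_ord ler_nat ltnn.
Qed.

(** Choose points greedily; each choice [t] rules out at most the points of
    [t B], [t B^-1] and [t] itself. *)
Lemma packing F B : exists T, [/\ (T `<=` F)%fset,
    forall s t, s \in T -> t \in T -> s != t -> (s^-1 * t)%g \notin B
  & (#|` F| <= #|` T| * (#|` B|.*2).+1)%N].
Proof.
have [k] := ubnP #|` F|; elim: k F => // k IH F; rewrite ltnS => leFk.
have [->|/fset0Pn[t tF]] := eqVneq F fset0.
  by exists fset0; split; rewrite ?fsub0set // cardfs0.
pose N :=
  (t |` ([fset (t * b)%g | b in B] `|` [fset (t * b^-1)%g | b in B]))%fset.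
have cardN : (#|` N| <= (#|` B|.*2).+1)%N.
  rewrite /N cardfsU1 -addnn -add1n; apply: leq_add; first by case: (_ \notin _).
  apply: (@leq_trans (#|` [fset (t * b)%g | b in B]%fset| +
                      #|` [fset (t * b^-1)%g | b in B]%fset|)).
    by rewrite -cardfsUI leq_addr.
  by apply: leq_add; exact: leq_imfset_card.
have tN : t \in N by rewrite !inE eqxx.
have [|T [TF sepT cardT]] := IH (F `\` N)%fset.
  apply: leq_trans leFk; rewrite -(cardfsID N F) -add1n leq_add2r cardfs_gt0.
  by apply/fset0Pn; exists t; rewrite inE tF tN.
have NT x : x \in T -> x \notin N by move/(fsubsetP TF); rewrite inE => /andP[].
have NB x : x \in T -> (t^-1 * x)%g \notin B /\ (x^-1 * t)%g \notin B.
  move=> /NT; rewrite !inE !negb_or => /and3P[_ n1 n2]; split.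
    apply: contra n1 => xB; apply/imfsetP; exists (t^-1 * x)%g => //.
    by rewrite mulVKg.
  apply: contra n2 => xB; apply/imfsetP; exists (x^-1 * t)%g => //.
  by rewrite invgM invgK mulVKg.
exists (t |` T)%fset; split.
- apply/fsubsetP => x; rewrite !inE => /predU1P[->//|/(fsubsetP TF)].
  by rewrite inE => /andP[].
- move=> s u; rewrite !inE => /predU1P[->|sT] /predU1P[->|uT].
  + by rewrite eqxx.
  + by move=> _; have [] := NB u uT.
  + by move=> _; have [] := NB s sT.
  + exact: sepT.
rewrite cardfsU1 (_ : t \notin T) ?mulSn; last first.
  by apply/negP => /NT; rewrite tN.
rewrite -(cardfsID N F); apply: leq_add => //.
by apply: leq_trans cardN; apply/fsubset_leq_card/fsubsetIr.
Qed.

(** A Folner set so invariant that even a separated subset, which keeps a fixed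
    proportion of its points, outnumbers [n] copies of the boundary. *)
Lemma amenable_sparse (R : realType) : amenable R G -> forall A B n,
  exists F T, [/\ (T `<=` F)%fset,
    forall s t, s \in T -> t \in T -> s != t -> (s^-1 * t)%g \notin B
  & (n * #|` (fmulset F A `\` F)%fset| < #|` T|)%N].
Proof.
move=> amG A B n.
have [F ltF] := amenable_folner amG A (n * (#|` B|.*2).+1).
have [T [TF sepT cardT]] := packing F B; exists F, T; split=> //.
by have := leq_trans ltF cardT; rewrite mulnAC ltn_pmul2r.
Qed.

End Folner.

(** * Linear compactness of V^I *)

Section AffineCompactness.
Variable K : fieldType.

Definition affine (E : lmodType K) (S : set E) : Prop :=
  forall a x y z, S x -> S y -> S z -> S (a *: (x - y) + z).

Lemma affineI (E : lmodType K) (S S' : set E) :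
  affine S -> affine S' -> affine (S `&` S').
Proof.
by move=> aS aS' a x y z [? ?] [? ?] [? ?]; split; [exact: aS|exact: aS'].
Qed.

Lemma subspace_directions (E : lmodType K) (S : set E) : S !=set0 -> affine S ->
  subspace [set v | exists x y, [/\ S x, S y & v = x - y]].
Proof.
move=> [x0 Sx0] aS; split; first by exists x0, x0; rewrite subrr.
move=> a _ _ [x [y [Sx Sy ->]]] [x' [y' [Sx' Sy' ->]]].
by exists (a *: (x - y) + x'), y'; split=> //; [exact: aS|rewrite addrA].
Qed.

(** Take a member of the family whose space of directions has least dimension: any
    smaller member has the same directions and therefore equals it, so this
    member is contained in all the others. *)
Lemma affine_directed_meet (W : vectType K) (A : set (set W)) (A0 : set W) :
  A A0 -> (forall S, A S -> S !=set0 /\ affine S) ->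
  (forall S S', A S -> A S' -> exists2 S'', A S'' & S'' `<=` S `&` S') ->
  exists w, forall S, A S -> S w.
Proof.
move=> AA0 Aaff Adir.
pose dir (S : set W) := [set v | exists x y, [/\ S x, S y & v = x - y]].
pose dimS n := `[< exists S (U : {vspace W}),
  [/\ A S, \dim U = n & forall v, v \in U <-> dir S v] >].
have dirU S : A S -> exists U : {vspace W}, forall v, v \in U <-> dir S v.
  by move=> /Aaff[S0 aS]; apply/subspace_vspace/subspace_directions.
have exn : exists n, dimS n.
  have [U UP] := dirU _ AA0.
  by exists (\dim U); apply/asboolP; exists A0, U.
have [n /asboolP[S [U [AS dimU US]]] minn] := ex_minnP exn.
have [[w Sw] _] := Aaff _ AS; exists w => S' AS'.
have [S'' AS'' sub] := Adir _ _ AS AS'.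
have [[x S''x] aS''] := Aaff _ AS''.
have [U'' U''S] := dirU _ AS''.
have U''U : (U'' <= U)%VS.
  apply/subvP => v /U''S[x1 [x2 [/sub[Sx1 _] /sub[Sx2 _] ->]]].
  by apply/US; exists x1, x2.
have eqU : (U'' == U)%VS.
  rewrite -(dimv_leqif_eq U''U) eqn_leq dimvS //= dimU; apply: minn.
  by apply/asboolP; exists S'', U''.
have : w - x \in U by apply/US; exists w, x; split=> //; have [] := sub _ S''x.
rewrite -(eqP eqU) => /U''S[x1 [x2 [S''1 S''2 e]]].
have -> : w = 1 *: (x1 - x2) + x by rewrite scale1r -e subrK.
by have [] := sub _ (aS'' 1 _ _ _ S''1 S''2 S''x).
Qed.

Variables (I : choiceType) (V : vectType K).
Implicit Types (S : set (I -> V)) (B : set (set (I -> V))).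

Let filter_base B :=
  (forall S, B S -> S !=set0 /\ affine S) /\
  (forall S S', B S -> B S' -> B (S `&` S')).

(* The values at [i] of the members of [B] form a directed family of nonempty
   affine subsets of [V]; a value [v] common to all of them can be imposed. *)
Let point_extension B (i : I) : filter_base B -> B !=set0 ->
  exists v, filter_base (B `|` [set S `&` [set x | x i = v] | S in B]).
Proof.
move=> [Baff BI] [S0 BS0].
have [|_ [S BS <-]||v vP] :=
    @affine_directed_meet V [set [set x i | x in S] | S in B] [set x i | x in S0].
- by exists S0.
- have [[x Sx] aS] := Baff _ BS; split; first by exists (x i), x.
  move=> a _ _ _ [u Su <-] [w Sw <-] [z Sz <-].
  by exists (a *: (u - w) + z) => //; exact: aS.
- move=> _ _ [S BS <-] [S' BS' <-]; exists [set x i | x in S `&` S'].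
    by exists (S `&` S') => //; exact: BI.
  by move=> _ [x [Sx S'x] <-]; split; exists x.
pose C := [set x : I -> V | x i = v].
have aC : affine C.
  move=> a x y z; rewrite /C /= => xi yi zi.
  by rewrite !fctE xi yi zi subrr scaler0 add0r.
exists v; split.
  move=> S1 [BS|[S BS <-]]; first exact: Baff.
  split; last by apply: affineI aC; have [] := Baff _ BS.
  by have [|x Sx xv] := vP [set x i | x in S]; [exists S|exists x].
move=> S1 S2 [BS|[S BS <-]] [BS'|[S' BS' <-]].
- by left; exact: BI.
- by right; exists (S1 `&` S'); rewrite ?setIA //; exact: BI.
- by right; exists (S `&` S2); [exact: BI|rewrite setIAC].
- by right; exists (S `&` S'); [exact: BI|rewrite setIACA setIid].
Qed.

(** The ultrafilter proof of Tychonoff's theorem, with affine subspaces in place of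
    arbitrary subsets: a maximal filter base of affine subspaces prescribes a
    value at each coordinate, because prescribing one extends the base.  The
    point with these coordinates is adherent to every member.  Finiteness of the
    alphabet is replaced by finite dimension. *)
Lemma affine_compactness B :
  (forall S, B S -> S !=set0 /\ affine S) ->
  (forall S S', B S -> B S' -> B (S `&` S')) ->
  exists x, forall S, B S -> forall F : {fset I},
    exists2 x', S x' & forall i, i \in F -> x' i = x i.
Proof.
move=> Baff BI; have [->|/set0P B0] := eqVneq B set0; first by exists 0.
pose P (F : set (set (I -> V))) := filter_base (B `|` F).
have [F FP Ftot|A [PA maxA]] := @Zorn_bigcup _ P.
  have [->|/set0P[D0 FD0]] := eqVneq F set0.
    by rewrite bigcup_set0 /P setU0.
  have inD S : (B `|` \bigcup_(D in F) D) S -> exists2 D, F D & (B `|` D) S.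
    by move=> [BS|[D FD DS]]; [exists D0 => //; left|exists D => //; right].
  split=> [S /inD[D FD DS]|S S' /inD[D FD DS] /inD[D' FD' D'S']].
    by have [+ _] := FP _ FD; exact.
  wlog DD' : D D' S S' FD FD' DS D'S' / D `<=` D'.
    move=> W; have [DD'|D'D] := Ftot _ _ FD FD'; first exact: (W D D').
    by rewrite setIC; exact: (W D' D).
  have [_ /(_ S S')] := FP _ FD'; case=> //.
  - by case: DS => [?|/DD' ?]; [left|right].
  - by left.
  - by right; exists D'.
have BA0 : B `|` A !=set0 by have [S BS] := B0; exists S; left.
have /choice[x xP] : forall i, exists v, forall S, (B `|` A) S ->
    (B `|` A) (S `&` [set x | x i = v]).
  move=> i; have [v ext] := point_extension i PA BA0.
  exists v => S BAS; right; apply: contrapT => nA.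
  pose A' := A `|` [set S `&` [set x | x i = v] | S in B `|` A].
  apply: (maxA A'); last by rewrite /P /A' setUA.
  split; first exact: subsetUl.
  by move=> /(_ (S `&` [set x | x i = v])) sub; apply/nA/sub; right; exists S.
exists x => S BS F.
suff : exists2 S', (B `|` A) S' &
    S' `<=` [set x' | S x' /\ forall i, i \in F -> x' i = x i].
  move=> [S' BAS' sub]; have [/(_ _ BAS')[[x' /sub[Sx' x'F]] _] _] := PA.
  by exists x'.
have : forall s : seq I, exists2 S', (B `|` A) S' &
    S' `<=` [set x' | S x' /\ forall i, i \in s -> x' i = x i].
  elim=> [|i s [S' BAS' sub]]; first by exists S => //; left.
  exists (S' `&` [set x' | x' i = x i]); first exact: xP.
  move=> x' [/sub[Sx' x's] x'i]; split=> // j.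
  by rewrite inE => /predU1P[->//|/x's].
exact.
Qed.

End AffineCompactness.

(** * Counting dimensions over finite sets of sites *)

Section RankDual.
Variables (K : fieldType) (E : lmodType K) (S : set E).
Hypothesis SS : subspace S.

Definition evals (T : finType) (l : T -> E -> K) (x : E) : {ffun T -> K^o} :=
  [ffun t => l t x].

Lemma evals_linear (T : finType) (l : T -> E -> K) :
  (forall t, linear_on S (l t : E -> K^o)) -> linear_on S (evals l).
Proof. by move=> lL a x y Sx Sy; apply/ffunP => t; rewrite !ffunE lL. Qed.

(** The image of [evals l] contains the standard basis, as the values at [e]. *)
Lemma rank_dual_family (T : finType) (l : T -> E -> K) (e : T -> E) :
  (forall t, linear_on S (l t : E -> K^o)) -> (forall t, S (e t)) ->
  (forall s t, l s (e t) = (s == t)%:R) ->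
  (#|T| <= rank S (evals l))%N.
Proof.
move=> lL eS le; have LL := evals_linear lL.
rewrite /rank; suff -> : image_vspace S (evals l) = {:{ffun T -> K^o}}%VS.
  by rewrite dimvf /= /dim /= muln1.
apply/vspaceP => w; rewrite memvf.
have -> : w = \sum_t w t *: evals l (e t).
  apply/ffunP => s; rewrite sum_ffunE (bigD1 s) //= big1 => [|t ts].
    by rewrite !ffunE le eqxx addr0 /GRing.scale /= mulr1.
  by rewrite !ffunE le eq_sym (negbTE ts) /GRing.scale /= mulr0.
apply: memv_suml => t _; apply: memvZ; apply/(image_vspaceP SS LL).
by exists (e t).
Qed.

End RankDual.

Section Restriction.
Variables (K : fieldType) (I : choiceType) (V : vectType K).
Implicit Types (F : {fset I}) (x y : I -> V) (S : set (I -> V)).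

Definition restr F x : {ffun F -> V} := [ffun i : F => x (val i)].

Lemma restr_eq F x y : restr F x = restr F y <-> forall i, i \in F -> x i = y i.
Proof.
split=> [/ffunP e i iF|e]; first by have := e [` iF]%fset; rewrite !ffunE.
by apply/ffunP => i; rewrite !ffunE e ?fsvalP.
Qed.

Lemma restr_eq0 F x : restr F x = 0 <-> forall i, i \in F -> x i = 0.
Proof.
have -> : 0 = restr F 0 by apply/ffunP => i; rewrite !ffunE.
exact: restr_eq.
Qed.

Lemma restr_linear S F : linear_on S (restr F).
Proof. by move=> a x y _ _; apply/ffunP => i; rewrite !ffunE !fctE. Qed.

Lemma rank_restr_le S F0 F : subspace S ->
  (rank S (restr F) <= rank S (restr F0) + \dim {:V} * #|` (F `\` F0)%fset|)%N.
Proof.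
move=> SS.
have le : (rank S (restr F) <=
           rank S (pairf (restr F0) (restr (F `\` F0)%fset)))%N.
  apply: rank_le_factor => //; first 2 last.
  - move=> x _ [/restr_eq0 x0 /restr_eq0 x1]; apply/restr_eq0 => i iF.
    case: (boolP (i \in F0)) => iF0; first exact: x0.
    by apply: x1; rewrite inE iF0.
  - by apply: linear_on_pair; exact: restr_linear.
  - exact: restr_linear.
apply: leq_trans le _; apply: leq_trans (rank_pair_le _ _ _) _ => //;
  [exact: restr_linear..|].
by rewrite leq_add2l !dimvf {1}/dim /= -cardfE mulnC.
Qed.

End Restriction.

(** * The two implications *)

Section LinearGardenOfEden.
Variables (R : realType) (G : groupType) (K : fieldType) (V : vectType K).
Variables (X : set (G -> V)) (tau : (G -> V) -> (G -> V)) (M : {fset G}).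
Implicit Types (F : {fset G}) (x y : G -> V).
Hypotheses (amG : amenable R G) (XS : subspace X).
Hypothesis Xshift : forall g x, X x -> X (Defs.shift g x).
Hypothesis Xtau : forall x, X x -> X (tau x).
Hypothesis tauL : forall a x y, X x -> X y ->
  tau (a *: x + y) = a *: tau x + tau y.
Hypothesis tau_shift : forall g x, X x ->
  tau (Defs.shift g x) = Defs.shift g (tau x).
Hypothesis tau_local : forall x y g, X x -> X y ->
  (forall m, m \in M -> x (g * m)%g = y (g * m)%g) -> tau x g = tau y g.

Lemma tau0 : tau 0 = 0.
Proof.
by have := tauL (-1) XS.1 XS.1; rewrite !scaleN1r !addNr.
Qed.

Lemma restr_tau_linear F : linear_on X (restr F \o tau).
Proof.
by move=> a x y Xx Xy; rewrite /= tauL // (@restr_linear _ _ _ setT).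
Qed.

Lemma subset_fmulset F A : 1%g \in A -> (F `<=` fmulset F A)%fset.
Proof.
move=> A1; apply/fsubsetP => g gF; apply/fmulsetP.
by exists g, 1%g; rewrite mulg1.
Qed.

(** The translates of [z] by [T] are independent: the functional reading the
    [z g0]-component at [t * g0] takes the value 1 on the translate by [t] and
    vanishes on the others, by separation of [T]. *)
Lemma surjective_pre_injective :
  set_surj X X tau -> forall z (E : {fset G}), X z -> tau z = 0 ->
  (forall g, g \notin E -> z g = 0) -> z = 0.
Proof.
move=> surj z E Xz tauz z0; apply/funext => g0; apply: contrapT => /eqP zg0.
have [l [lL _ lz]] : exists l : V -> K,
    [/\ linear (l : V -> K^o), forall u, u \in 0%VS -> l u = 0 & l (z g0) = 1].
  by apply: separating_functional; rewrite memv0.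
have l0 : l 0 = 0 by have := lL (-1) 0 0; rewrite !scaleN1r !addNr.
pose A := (g0 |` M)%fset.
pose B := [fset (e * g0^-1)%g | e in E]%fset.
have [F0 [T [TF0 sepT ltT]]] := amenable_sparse amG A B (\dim {:V}).
pose F := fmulset F0 A.
pose lam (t : T) x := l (x (val t * g0)%g).
pose e (t : T) := Defs.shift (val t) z.
have lamL t S : linear_on S (lam t : _ -> K^o).
  by move=> a x y _ _; rewrite /lam !fctE lL.
have lame s t : lam s (e t) = (s == t)%:R.
  rewrite /lam /e /Defs.shift mulgA; have [->|st] := eqVneq s t.
    by rewrite mulVg mul1g lz.
  rewrite z0 // ?l0 //; apply/negP => sE.
  have := sepT (val t) (val s) (fsvalP t) (fsvalP s).
  rewrite (inj_eq val_inj) eq_sym => /(_ st)/negP; apply; apply/imfsetP.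
  by exists ((val t)^-1 * val s * g0)%g => //; rewrite mulgK.
pose g := restr F0 \o tau.
have gL : linear_on X g by exact: restr_tau_linear.
have fL (S : set (G -> V)) : linear_on S (restr F) by exact: restr_linear.
have kS : subspace (ker_on X g) by exact: subspace_ker.
have fg x : X x -> restr F x = 0 -> g x = 0.
  move=> Xx /restr_eq0 x0; apply/restr_eq0 => h hF0.
  rewrite -[RHS]/((0 : G -> V) h) -tau0; apply: tau_local => // [|m mM].
    exact: XS.1.
  by rewrite x0 //; apply: mem_fmulset; rewrite // inE mM orbT.
have rk_g : (rank X (restr F0) <= rank X g)%N.
  apply: rank_le_image => //; first exact: restr_linear.
  by move=> y /surj[x Xx <-]; exists x.
have rk_ker : (#|` T| <= rank (ker_on X g) (restr F))%N.
  rewrite cardfE.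
  apply: leq_trans (rank_dual_family kS (fun t => lamL t _) _ lame) _.
    move=> t; split; first exact: Xshift.
    by apply/restr_eq0 => h _; rewrite tau_shift // tauz.
  apply: rank_le_factor => //.
    by apply: evals_linear => t; exact: lamL.
  move=> x _ /restr_eq0 x0; apply/ffunP => t; rewrite !ffunE /lam x0 ?l0 //.
  by apply: mem_fmulset; rewrite ?(fsubsetP TF0) ?fsvalP // !inE eqxx.
have rk_le : (rank X (restr F) <=
    rank X (restr F0) + \dim {:V} * #|` (F `\` F0)%fset|)%N.
  exact: rank_restr_le.
have := rank_ker XS (fL X) gL fg.
move: ltT; rewrite -/F; lia.
Qed.

Hypothesis X_finite_type : exists D : {fset G}, forall x,
  (forall g, exists2 y, X y & forall d, d \in D -> x (g * d)%g = y (g * d)%g) ->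
  X x.

(** A configuration whose finite patterns all occur in [X] satisfies the local
    rules defining [X]. *)
Lemma X_closed x :
  (forall F, exists2 y, X y & forall g, g \in F -> x g = y g) -> X x.
Proof.
move=> loc; have [D XD] := X_finite_type; apply: XD => g.
have [y Xy xy] := loc [fset (g * d)%g | d in D]%fset.
by exists y => // d dD; apply: xy; apply/imfsetP; exists d.
Qed.

(** The solutions in [X] of [tau x = y] on finite sets form a filter base of affine
    subspaces.  A point adherent to all of them lies in [X], and satisfies each
    equation because it agrees with a solution on a neighbourhood. *)
Lemma image_closed y :
  (forall F, exists2 x, X x & forall g, g \in F -> tau x g = y g) ->
  exists2 x, X x & tau x = y.
Proof.
move=> loc.
pose sol F := [set x | X x /\ forall g, g \in F -> tau x g = y g].
have [_ [F _ <-]|_ _ [F _ <-] [F' _ <-]|x xP] :=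
    @affine_compactness K G V [set sol F | F in setT].
- split; first by have [x Xx xF] := loc F; exists x.
  move=> a u v w [Xu uF] [Xv vF] [Xw wF].
  have Xuv : X (u - v) by rewrite addrC -scaleN1r; apply: XS.2.
  split=> [|g gF]; first exact: XS.2.
  have -> : tau (a *: (u - v) + w) = a *: (tau u - tau v) + tau w.
    rewrite tauL //; congr (_ *: _ + _).
    by rewrite addrC -scaleN1r tauL // scaleN1r addrC.
  by rewrite !fctE uF // vF // wF // subrr scaler0 add0r.
- exists (F `|` F')%fset => //; apply/seteqP; split=> [u [Xu uF]|].
    by split; split=> // g gF; apply: uF; rewrite inE gF ?orbT.
  move=> u [[Xu uF] [_ uF']]; split=> // g.
  by rewrite inE => /orP[]; [exact: uF|exact: uF'].
have Xx : X x.
  apply: X_closed => F; have [|x' [Xx' _] x'x] := xP (sol fset0) _ F.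
    by exists fset0.
  by exists x' => // g gF; rewrite x'x.
exists x => //; apply/funext => g.
have [|x' [Xx' x'y] x'x] :=
    xP (sol [fset g]%fset) _ [fset (g * m)%g | m in M]%fset.
  by exists [fset g]%fset.
rewrite -x'y ?inE //; apply: tau_local => // m mM.
by rewrite x'x //; apply/imfsetP; exists m.
Qed.

(* Strong irreducibility, gluing a configuration with the zero configuration. *)
Hypothesis X_irreducible : exists2 P : {fset G}, 1%g \in P &
  forall x (W F : {fset G}), X x -> exists2 y, X y &
    (forall g, g \in W -> y g = x g) /\
    (forall g, g \in F -> g \notin fmulset W P -> y g = 0).

(** Glue the pattern with zero on a collar wide enough for the local rules of [X],
    then replace everything beyond the collar by zero: each translate of the
    defining window sees either the glued configuration or zero. *)
Lemma finite_support_extension : exists2 P : {fset G}, 1%g \in P &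
  forall x F, X x -> exists2 y, X y &
    (forall g, g \in F -> y g = x g) /\
    (forall g, g \notin fmulset F P -> y g = 0).
Proof.
have [P P1 XP] := X_irreducible; have [D XD] := X_finite_type.
exists P => // x F Xx.
(* [N] contains every window that meets [F P]. *)
pose N := fmulset (fmulset F P) [fset (d^-1 * d')%g | d in D, d' in D]%fset.
have [y Xy [yx y0]] := XP x F N Xx.
pose z g := if g \in fmulset F P then y g else 0.
exists z; last first.
  split=> g gF; rewrite /z; last by rewrite (negbTE gF).
  by rewrite (fsubsetP (subset_fmulset F P1)) // yx.
apply: XD => g.
have [[d dD gd]|nd] := pselect (exists2 d, d \in D & (g * d)%g \in fmulset F P).
  exists y => // d' d'D; rewrite /z; case: ifPn => // gd'.
  rewrite y0 //; have -> : (g * d' = g * d * (d^-1 * d'))%g.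
    by rewrite mulgA mulgK.
  by apply: mem_fmulset => //; apply/imfset2P; exists d => //; exists d'.
exists 0; first exact: XS.1.
move=> d dD; rewrite /z; case: ifPn => // gd.
by case: nd; exists d.
Qed.

(** With [XF] the elements of [X] supported in [F0 P] and [L] the family of
    translated functionals, the ranks satisfy
    [restr F0] on [X] <= [restr F0] on [XF] <= [restr F \o tau] on [XF]
    <= [restr F] on the kernel of [L] <= ([restr F] on [X]) - #|T|. *)
Lemma pre_injective_surjective :
  (forall z (E : {fset G}), X z -> tau z = 0 ->
    (forall g, g \notin E -> z g = 0) -> z = 0) ->
  set_surj X X tau.
Proof.
move=> preinj y Xy; apply: contrapT => ny.
have /existsNP[W nW] : ~ forall F,
    exists2 x, X x & forall g, g \in F -> tau x g = y g.
  by move=> /image_closed[x Xx xy]; apply: ny; exists x.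
have tauWL := restr_tau_linear W.
have [|l [lL lU ly]] := @separating_functional _ _
    (image_vspace X (restr W \o tau)) (restr W y).
  apply/negP => /(image_vspaceP XS tauWL)[x Xx /restr_eq xy].
  by apply: nW; exists x.
have ltau x : X x -> l (restr W (tau x)) = 0.
  by move=> Xx; apply/lU/(image_vspaceP XS tauWL); exists x.
have l0 : l 0 = 0 by have := lL (-1) 0 0; rewrite !scaleN1r !addNr.
have [P P1 XP] := finite_support_extension.
have [Q Q1 XQ] := X_irreducible.
pose A := (W `|` fmulset P [fset m^-1 | m in M]%g)%fset.
pose B := fmulset (fmulset W Q) [fset o^-1 | o in W]%g%fset.
have [F0 [T [TF0 sepT ltT]]] := amenable_sparse amG A B (\dim {:V}).
pose F := fmulset F0 A.
pose XF := [set x | X x /\ forall g, g \notin fmulset F0 P -> x g = 0].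
have XFS : subspace XF.
  split; first by split=> //; exact: XS.1.
  move=> a u v [Xu u0] [Xv v0]; split=> [|g gF]; first exact: XS.2.
  by rewrite !fctE u0 // v0 // scaler0 addr0.
have XFX : XF `<=` X by move=> ? [].
(* A functional on the window [W], seen from the site [t]; it kills the image of
   [tau]. *)
pose lam (t : T) x := l (restr W (Defs.shift (val t)^-1%g x)).
have lamL t S : linear_on S (lam t : _ -> K^o).
  by move=> a u v _ _; rewrite /lam -lL -(@restr_linear _ _ _ setT).
(* [z] agrees with [y] on [W] and vanishes on the other windows [t^-1 s W]; its
   translates by [T] are then dual to the functionals [lam]. *)
pose N :=
  [fset (ts * o)%g | ts in [fset (t^-1 * s)%g | t in T, s in T], o in W]%fset.
have [z Xz [zy z0]] := XQ y W N Xy.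
pose e (t : T) := Defs.shift (val t) z.
have lame s t : lam s (e t) = (s == t)%:R.
  rewrite /lam /e; have [->|st] := eqVneq s t.
    rewrite -[RHS]ly; congr l; apply/restr_eq => o oW.
    by rewrite /Defs.shift invgK mulKg zy.
  rewrite -[RHS]l0; congr l; apply/restr_eq0 => o oW.
  rewrite /Defs.shift invgK mulgA z0 //.
    apply/imfset2P; exists ((val t)^-1 * val s)%g; last by exists o.
    apply/imfset2P; exists (val t); rewrite ?fsvalP //.
    by exists (val s); rewrite ?fsvalP.
  apply/negP => tsoQ.
  have := sepT (val t) (val s) (fsvalP t) (fsvalP s).
  rewrite (inj_eq val_inj) eq_sym => /(_ st)/negP; apply.
  apply/fmulsetP; exists ((val t)^-1 * val s * o)%g, o^-1%g; split=> //.
    by apply/imfsetP; exists o.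
  by rewrite mulgK.
pose L := evals lam.
have LL S : linear_on S L by apply: evals_linear => t; exact: lamL.
have kS : subspace (ker_on X L) by exact: subspace_ker.
have rkT : (#|` T| <= rank X L)%N.
  rewrite cardfE; apply: (rank_dual_family XS (fun t => lamL t _) _ lame) => t.
  exact: Xshift.
have fL x : X x -> restr F x = 0 -> L x = 0.
  move=> _ /restr_eq0 x0; apply/ffunP => t; rewrite !ffunE -[RHS]l0; congr l.
  apply/restr_eq0 => o oW; rewrite /Defs.shift invgK x0 //.
  by apply: mem_fmulset; rewrite ?(fsubsetP TF0) ?fsvalP // inE oW.
have := rank_ker XS (@restr_linear _ _ _ _ F) (LL X) fL.
have tauFL : linear_on XF (restr F \o tau).
  exact: linear_on_sub (restr_tau_linear F).
have rk1 : (rank X (restr F0) <= rank XF (restr F0))%N.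
  apply: rank_le_image => //; [exact: restr_linear..|].
  move=> x Xx; have [x' Xx' [x'x x'0]] := XP x F0 Xx.
  by exists x' => //; apply/restr_eq.
have rk2 : (rank XF (restr F0) <= rank XF (restr F \o tau))%N.
  apply: rank_le_factor => //; first exact: restr_linear.
  move=> x [Xx x0] /restr_eq0 taux; suff -> : x = 0 by apply/restr_eq0.
  apply: (preinj _ (fmulset F0 P)) => //; apply/funext => g.
  case: (boolP (g \in F)) => [/taux //|gF].
  rewrite -tau0; apply: tau_local => // [|m mM]; first exact: XS.1.
  rewrite x0 //; apply: contra gF => /fmulsetP[f [p [fF0 pP e1]]].
  apply/fmulsetP; exists f, (p * m^-1)%g; split=> //.
    rewrite inE; apply/orP; right; apply/fmulsetP; exists p, m^-1%g; split=> //.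
    by apply/imfsetP; exists m.
  by rewrite mulgA -e1 mulgK.
have rk3 : (rank XF (restr F \o tau) <= rank (ker_on X L) (restr F))%N.
  apply: rank_le_image => //; first exact: restr_linear.
  move=> x [Xx _]; exists (tau x) => //; split; first exact: Xtau.
  by apply/ffunP => t; rewrite !ffunE /lam -tau_shift // ltau //; exact: Xshift.
have rk_le : (rank X (restr F) <=
    rank X (restr F0) + \dim {:V} * #|` (F `\` F0)%fset|)%N.
  exact: rank_restr_le.
move: ltT; rewrite -/F; lia.
Qed.

End LinearGardenOfEden.

(** * Reading the definitions site by site *)

Lemma shift_mul (G : groupType) (A : choiceType) (g h : G) (x : G -> A) :
  Defs.shift g (Defs.shift h x) = Defs.shift (g * h)%g x.
Proof. by apply/funext => k; rewrite /Defs.shift invgM mulgA. Qed.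

Lemma shiftVE (G : groupType) (A : choiceType) (g h : G) (x : G -> A) :
  Defs.shift g^-1%g x h = x (g * h)%g.
Proof. by rewrite /Defs.shift invgK. Qed.

Lemma sigL_eqP (T A : Type) (W : set T) (x y : T -> A) :
  sigL W x = sigL W y <-> forall i, W i -> x i = y i.
Proof.
rewrite -eq_sigLP; split=> e i; first by move/mem_set/e.
by move/set_mem/e.
Qed.

Section CellularAutomaton.
Variables (G : groupType) (A : choiceType) (X : set (G -> A)).
Implicit Types x y : G -> A.

Lemma cellular_automaton_shift tau : (forall g x, X x -> X (Defs.shift g x)) ->
  cellular_automaton X X tau ->
  forall g x, X x -> tau (Defs.shift g x) = Defs.shift g (tau x).
Proof.
move=> Xshift [_ [M [mu [_ tauE]]]] g x Xx; apply/funext => h.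
rewrite tauE; last exact: Xshift.
by rewrite shift_mul {2}/Defs.shift tauE // invgM invgK.
Qed.

Lemma cellular_automaton_local tau : cellular_automaton X X tau ->
  exists M : {fset G}, forall x y g, X x -> X y ->
    (forall m, m \in M -> x (g * m)%g = y (g * m)%g) -> tau x g = tau y g.
Proof.
move=> [_ [M [mu [finM tauE]]]]; exists (fset_set M) => x y g Xx Xy xy.
rewrite !tauE //; congr mu; apply/sigL_eqP => m Mm; rewrite !shiftVE.
by apply: xy; rewrite in_fset_set //; exact: mem_set.
Qed.

Lemma finite_type_local : finite_type X -> exists D : {fset G}, forall x,
  (forall g, exists2 y, X y & forall d, d \in D -> x (g * d)%g = y (g * d)%g) ->
  X x.
Proof.
move=> [D [L [finD XE]]]; exists (fset_set D) => x xloc; rewrite XE => g.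
have [y + xy] := xloc g; rewrite XE => /(_ g); congr L.
apply/sigL_eqP => d Dd; rewrite !shiftVE xy //.
by rewrite in_fset_set //; exact: mem_set.
Qed.

(** The set [P] consists of the inverses of the elements of the irreducibility
    window, so that a site [g] outside [W P] has [g * d] outside [W] for every
    [d] of that window; adding 1 makes [W P] contain [W]. *)
Lemma strongly_irreducible_glue x0 : X x0 -> strongly_irreducible X ->
  exists2 P : {fset G}, 1%g \in P &
    forall x (W F : {fset G}), X x -> exists2 y, X y &
      (forall g, g \in W -> y g = x g) /\
      (forall g, g \in F -> g \notin fmulset W P -> y g = x0 g).
Proof.
move=> Xx0 [Delta [finD irr]].
exists (1%g |` [fset d^-1 | d in fset_set Delta]%g)%fset.
  by rewrite !inE eqxx.
set P := (_ |` _)%fset => x W F Xx.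
have [|y [Xy /sigL_eqP yx /sigL_eqP y0]] :=
    irr [set` W] [set` (F `\` fmulset W P)%fset] (finite_fset _) (finite_fset _)
      _ x x0 Xx Xx0.
  move=> [g /= + [_ [[d Dd <-] /= gdW]]]; rewrite inE.
  move=> /andP[/negP + _]; apply.
  apply/fmulsetP; exists (g * d)%g, d^-1%g; split=> //; last by rewrite mulgK.
  rewrite inE; apply/orP; right; apply/imfsetP; exists d => //=.
  by rewrite in_fset_set //; exact: mem_set.
exists y => //; split=> [g gW|g gF gP]; first exact: yx.
by apply: y0; rewrite /= inE gP.
Qed.

End CellularAutomaton.

Theorem theorem1p2 (R : realType) (G : groupType) (K : fieldType)
    (V : vectType K) (X : set (G -> V)) (tau : (G -> V) -> (G -> V)) :
  amenable R G ->
  linear_subshift X -> strongly_irreducible X -> finite_type X ->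
  linear_cellular_automaton X X tau ->
  set_surj X X tau <-> pre_injective X tau.
Proof.
move=> amG [[_ Xshift] [X0 XL]] Xirr Xft [tauCA tauL].
have XS : subspace X.
  split=> [|a x y Xx Xy]; first exact: set_mem X0.
  by apply: set_mem; apply: XL; exact: mem_set.
have Xtau x : X x -> X (tau x) by exact: tauCA.1.
have tau_shift := cellular_automaton_shift Xshift tauCA.
have [M tau_local] := cellular_automaton_local tauCA.
split=> [surj x1 x2 X1 X2 [F [finF /sigL_eqP x12]] tau12|preinj].
  have Xz : X (-1 *: x2 + x1) by exact: XS.2.
  apply: subr0_eq; rewrite addrC -scaleN1r.
  apply: (surjective_pre_injective amG XS Xshift tauL tau_shift tau_local
    surj (E := fset_set F)) => // [|g gF].
    by rewrite tauL // tau12 scaleN1r addNr.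
  rewrite !fctE scaleN1r x12 ?addNr // => Fg.
  by move: gF; rewrite in_fset_set // mem_set.
apply: (pre_injective_surjective amG XS Xshift Xtau tauL tau_shift tau_local
  (finite_type_local Xft) (strongly_irreducible_glue XS.1 Xirr)).
move=> z E Xz tauz z0; apply: preinj => //; first exact: XS.1.
  exists [set` E]; split; first exact: finite_fset.
  by apply/sigL_eqP => g /= /negP; exact: z0.
by rewrite tauz (tau0 XS tauL).
Qed.
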